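(* Let $m,n\in\mathbb N$, let $\Omega\subset\mathbb R^n$ be non-empty, open and proper, let $\mathcal C$ be a Whitney decomposition of $\Omega$, and for each $Q\in\mathcal C$ let $\phi_Q$ and $\phi_Q^*:\mathcal A_m(\Omega^* )\to\mathcal A_m(\mathbb R^{n+1})$ be the maps described in the context. Then for any $p,q\in\mathcal A_m(\Omega^* )$, $$\frac{W_2(p,q)^2}{c_3m^3}\le\sum_{Q\in\mathcal C}W_2(\phi_Q^*(p),\phi_Q^*(q))^2\le c_3W_2(p,q)^2,$$ where $c_3\ge1$ depends only upon $n$.
   Context: Shortcut space: $\Omega^*=\Omega\cup\{\partial\}$, where $\partial$ is an additional point, with the metric $\delta(x,y)=\min\{\|x-y\|,\operatorname{dist}(x,\partial\Omega)+\operatorname{dist}(y,\partial\Omega)\}$ for $x,y\in\Omega$ and $\delta(x,\partial)=\operatorname{dist}(x,\partial\Omega)$. Unordered tuples: for a metric space $(Y,d)$, $\mathcal A_m(Y)=\{\sum_{i=1}^m[\![y_i]\!]:y_i\in Y\}$, where $[\![y]\!]$ is the Dirac mass at $y$, with the metric $W_2(p,q)=\min_{\sigma\in\Sigma_m}\big(\sum_{i=1}^md(p_i,q_{\sigma(i)})^2\big)^{1/2}$ for $p=\sum_i[\![p_i]\!]$, $q=\sum_i[\![q_i]\!]$; $\Sigma_m$ is the symmetric group. $\Omega^*$ carries $\delta$ and $\mathbb R^{n+1}$ the Euclidean metric. Whitney decomposition: a family $\mathcal C$ of closed cubes, with $l(Q)$ the side length of $Q$, such that: $\bigcup\mathcal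 C=\Omega$ and the elements of $\mathcal C$ have disjoint interiors; $\sqrt n\,l(Q)\le\operatorname{dist}(Q,\partial\Omega)\le4\sqrt n\,l(Q)$ for all $Q\in\mathcal C$; if $Q,Q'\in\mathcal C$ with $Q\cap Q'\ne\emptyset$ (in which case $Q,Q'$ are called neighbours) then $\frac14\le l(Q)/l(Q')\le4$; each $Q\in\mathcal C$ has at most $12^n$ neighbours. $B(Q,r)$ denotes the closed $r$-neighbourhood of $Q$. The maps $\phi_Q$: for each $Q\in\mathcal C$, $\phi_Q:\Omega^*\to\mathbb R^{n+1}$ is a fixed map with $\phi_Q(\partial)=0$ such that (1) $\phi_Q|_\Omega$ is $9\sqrt{n+1}$-Lipschitz for the Euclidean metric; (2) $\phi_Q(x)=0$ for all $x\notin B(Q,l(Q)/4)$; in particular, $\phi_Q$ is supported on the neighbours of $Q$; (3) $\|\phi_Q\|_\infty\le\sqrt{n+1}\,l(Q)$; (4) $\|\phi_Q(x)-\phi_Q(y)\|=\|x-y\|$ for all $x,y\in B(Q,l(Q)/8)$; (5) $\phi_Q$ is $9\sqrt{n+1}$-Lipschitz on $\Omega^*$ with respect to $\delta$; (6) if $x\in B(Q,l(Q)/8)$ and $y\in\Omega^*$ then $\|\phi_Q(x)-\phi_Q(y)\|\ge\min\{\|x-y\|/(2\sqrt n),\,l(Q)\}$, where for $y=\partial$ the right-hand side is read as $l(Q)$. Then $\phi_Q^*\big(\sum_{i=1}^m[\![p_i]\!]\big)=\sum_{i=1}^m[\![\phi_Q(p_i)]\!]$. *)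

(* Defs.v *)
Set Warnings "-notation-overridden,-ambiguous-paths,-notation-incompatible-prefix".
From mathcomp Require Export all_boot all_order all_algebra all_fingroup.
From mathcomp Require Export finmap multiset.
From mathcomp Require Export all_classical all_reals all_analysis.
Import Order.TTheory GRing.Theory Num.Theory.
Import numFieldNormedType.Exports.

Set Implicit Arguments.
Unset Strict Implicit.
Unset Printing Implicit Defensive.

Local Open Scope classical_set_scope.
Local Open Scope ring_scope.

Section Euclidean.
Variables (R : realType) (n : nat).
Implicit Types (x y : 'rV[R]_n) (A B : set 'rV[R]_n).

(* The library norm on row vectors is the sup norm; its topology is the
   Euclidean one, but the metric statements need the l2 norm. *)
Definition enorm x : R := Num.sqrt (\sum_i x ord0 i ^+ 2).
Definition edistance x y : R := enorm (x - y).

(* [inf] is only meaningful for nonempty sets (inf set0 = 0); below it is used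
   with nonempty [A] and [B] only. *)
Definition dist_pt x A : R := inf [set edistance x y | y in A].
Definition dist_set A B : R :=
  inf [set d | exists x y, [/\ A x, B y & d = edistance x y]].

Definition closed_nbhd A (r : R) : set 'rV[R]_n := [set x | dist_pt x A <= r].

Definition boundary A : set 'rV[R]_n := closure A `\` A°.

End Euclidean.

Section Shortcut.
Variables (R : realType) (n : nat) (Omega : set 'rV[R]_n).

(* [None] is the additional point; [Omega] is coerced to {x | x \in Omega}. *)
Definition shortcut : Type := option Omega.

Definition delta (x y : shortcut) : R :=
  match x, y with
  | Some x, Some y =>
      Num.min (edistance (val x) (val y))
        (dist_pt (val x) (boundary Omega) + dist_pt (val y) (boundary Omega))
  | Some x, None => dist_pt (val x) (boundary Omega)
  | None, Some y => dist_pt (val y) (boundary Omega)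
  | None, None => 0
  end.

End Shortcut.

Section UnorderedTuples.
Variables (m : nat) (Y : choiceType).

(* A sum of m Dirac masses is encoded by its multiplicity function, i.e. a
   multiset with m elements counted with multiplicity. *)
Definition utuple : Type := {p : {mset Y}%mset | size p == m}.

Lemma size_dirac_sum (y : 'I_m -> Y) : size (seq_mset (codom y)) == m.
Proof. by rewrite (perm_size (perm_eq_seq_mset _)) size_codom card_ord. Qed.

(* The sum of the Dirac masses at the points y i. *)
Definition dirac_sum (y : 'I_m -> Y) : utuple :=
  exist _ (seq_mset (codom y)) (size_dirac_sum y).

Lemma dirac_sumE (y : 'I_m -> Y) (a : Y) :
  (val (dirac_sum y) : {mset Y}%mset) a = (\sum_(i < m) (y i == a))%N.
Proof. by rewrite /= mset_seqE /codom count_map -sum1_count big_mkcond big_enum. Qed.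

Lemma dirac_sum_perm (y : 'I_m -> Y) (s : 'S_m) :
  dirac_sum (y \o s) = dirac_sum y.
Proof.
apply: val_inj; apply/msetP => a; rewrite !dirac_sumE.
by rewrite [RHS](reindex_inj (@perm_inj _ s)).
Qed.

Definition points (p : utuple) : 'I_m -> Y :=
  tnth (Tuple (valP p : size (val p : seq Y) == m)).

Lemma pointsK (p : utuple) : dirac_sum (points p) = p.
Proof.
apply: val_inj; rewrite /= -[RHS]seq_mset_id; congr seq_mset.
exact: (map_tnth_enum (Tuple (valP p : size (val p : seq Y) == m))).
Qed.

Lemma points_dirac_sum (y : 'I_m -> Y) :
  exists s : 'S_m, forall i, points (dirac_sum y) i = y (s i).
Proof.
have : perm_eq (Tuple (valP (dirac_sum y) : size (val (dirac_sum y) : seq Y) == m))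
               [tuple y i | i < m].
  rewrite /=; apply: (perm_trans (perm_eq_seq_mset _)).
  by rewrite /codom /image_mem.
move=> /tuple_permP[s E]; exists s => i.
rewrite /points; have -> : Tuple (valP (dirac_sum y) : size (val (dirac_sum y) : seq Y) == m)
  = [tuple tnth [tuple y i | i < m] (s i) | i < m] by exact: val_inj.
by rewrite !tnth_mktuple.
Qed.

End UnorderedTuples.

Section Wasserstein.
Variables (R : realType) (m : nat).

Definition matching_cost (Y : Type) (d : Y -> Y -> R) (y z : 'I_m -> Y)
    (s : 'S_m) : R :=
  Num.sqrt (\sum_i d (y i) (z (s i)) ^+ 2).

(* The base point of the iterated minimum is itself one of the minimised
   values, so that this is the minimum over 'S_m. *)
Definition min_cost (Y : Type) (d : Y -> Y -> R) (y z : 'I_m -> Y) : R :=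
  \big[Num.min/matching_cost d y z 1%g]_(s : 'S_m) matching_cost d y z s.

Definition W2 (Y : choiceType) (d : Y -> Y -> R) (p q : utuple m Y) : R :=
  min_cost d (points p) (points q).

Lemma min_cost_perm (Y : Type) (d : Y -> Y -> R) (y z : 'I_m -> Y)
    (s t : 'S_m) :
  min_cost d (y \o s) (z \o t) = min_cost d y z.
Proof.
have H u : matching_cost d (y \o s) (z \o t) u
    = matching_cost d y z (s^-1 * u * t)%g.
  rewrite /matching_cost; congr Num.sqrt.
  rewrite [RHS](reindex_inj (@perm_inj _ s)); apply: eq_bigr => i _ /=.
  by rewrite !permM permK.
have H' u : matching_cost d y z u
    = matching_cost d (y \o s) (z \o t) (s * u * t^-1)%g.
  by rewrite H !mulgA mulVg mul1g -!mulgA mulVg mulg1.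
apply/eqP; rewrite eq_le; apply/andP; split.
  apply: le_bigmin => [|u _]; rewrite H'; exact: bigmin_le.
apply: le_bigmin => [|u _]; rewrite H; exact: bigmin_le.
Qed.

Lemma W2_dirac_sum (Y : choiceType) (d : Y -> Y -> R) (y z : 'I_m -> Y) :
  W2 d (dirac_sum y) (dirac_sum z) = min_cost d y z.
Proof.
have [s Hs] := points_dirac_sum y; have [t Ht] := points_dirac_sum z.
by rewrite -(min_cost_perm d y z s t) /W2; congr min_cost; apply/funext.
Qed.

Definition push (Y Z : choiceType) (f : Y -> Z) (p : utuple m Y) : utuple m Z :=
  dirac_sum (f \o points p).

Lemma push_dirac_sum (Y Z : choiceType) (f : Y -> Z) (y : 'I_m -> Y) :
  push f (dirac_sum y) = dirac_sum (f \o y).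
Proof.
have [s Hs] := points_dirac_sum y.
rewrite /push -(dirac_sum_perm (f \o y) s); congr dirac_sum.
by apply/funext => i /=; rewrite Hs.
Qed.

End Wasserstein.

Section Whitney.
Variables (R : realType) (n : nat).

(* A cube with sides parallel to the axes, given by its least corner and its
   side length. *)
Definition cube : Type := ('rV[R]_n * R)%type.

Definition side (Q : cube) : R := Q.2.
Definition cube_set (Q : cube) : set 'rV[R]_n :=
  [set x | forall i, Q.1 ord0 i <= x ord0 i <= Q.1 ord0 i + side Q].

Definition neighbours (Q Q' : cube) : Prop :=
  cube_set Q `&` cube_set Q' !=set0.

Record whitney_decomposition (Omega : set 'rV[R]_n) (C : set cube) : Prop := {
  whitney_side_gt0 : forall Q, C Q -> 0 < side Q;
  whitney_cover : \bigcup_(Q in C) cube_set Q = Omega;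
  whitney_disjoint : trivIset C (fun Q => (cube_set Q)°);
  whitney_dist : forall Q, C Q ->
    Num.sqrt n%:R * side Q <= dist_set (cube_set Q) (boundary Omega)
      <= 4 * Num.sqrt n%:R * side Q;
  whitney_ratio : forall Q Q', C Q -> C Q' -> neighbours Q Q' ->
    4^-1 <= side Q / side Q' <= 4;
  whitney_card : forall Q, C Q ->
    ([set Q' | C Q' /\ neighbours Q Q'] #<= `I_(12 ^ n))%card
}.

(* The points of [Omega] in the closed r-neighbourhood of Q, as points of the
   shortcut space. *)
Definition near_cube (Omega : set 'rV[R]_n) (Q : cube) (r : R) :
    set (shortcut Omega) :=
  [set x | if x is Some x then closed_nbhd (cube_set Q) r (val x) else False].

Record whitney_map (Omega : set 'rV[R]_n) (Q : cube)
    (phi : shortcut Omega -> 'rV[R]_n.+1) : Prop := {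
  wmap_base : phi None = 0;
  wmap_lipschitz : forall x y : Omega,
    edistance (phi (Some x)) (phi (Some y))
      <= 9 * Num.sqrt n.+1%:R * edistance (val x) (val y);
  wmap_support : forall x : shortcut Omega,
    ~ near_cube Q (side Q / 4) x -> phi x = 0;
  wmap_bounded : forall x : shortcut Omega,
    enorm (phi x) <= Num.sqrt n.+1%:R * side Q;
  wmap_isometric : forall x y : Omega,
    closed_nbhd (cube_set Q) (side Q / 8) (val x) ->
    closed_nbhd (cube_set Q) (side Q / 8) (val y) ->
    edistance (phi (Some x)) (phi (Some y)) = edistance (val x) (val y);
  wmap_lipschitz_delta : forall x y : shortcut Omega,
    edistance (phi x) (phi y) <= 9 * Num.sqrt n.+1%:R * delta x y;
  wmap_separated : forall (x : Omega) (y : shortcut Omega),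
    closed_nbhd (cube_set Q) (side Q / 8) (val x) ->
    (if y is Some y then
       Num.min (edistance (val x) (val y) / (2 * Num.sqrt n%:R)) (side Q)
     else side Q)
    <= edistance (phi (Some x)) (phi y)
}.

End Whitney.

(* Main.v *)
(* Upper bound: push an optimal matching of p and q forward by every phi_Q. Each
   matched pair contributes only for the cubes near one of its two points, and
   their number is bounded in terms of n by packing.

   Lower bound: put r = (sum_Q W_2(phi_Q^* p, phi_Q^* q)^2)^(1/2) and join two of
   the 2m points of p and q when their Euclidean distance is at most 2 sqrt(n) r.
   If all points of a connected component are farther than 160 n m r from the
   boundary, the component lies in B(Q, l(Q)/8) for one cube Q with l(Q) > r;
   the optimal matching for phi_Q moves images by at most r, so it preserves the
   component, which thus contains equally many points of p and of q. By
   counting, so does the union of the other components, all of whose points are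
   within 164 n m r of the boundary. Matching inside these classes moves each
   point by at most 328 n m r for the shortcut metric. *)

Require Import Defs.
From mathcomp Require Import ring lra.
Import Order.TTheory GRing.Theory Num.Theory.
Import numFieldNormedType.Exports.
Local Open Scope classical_set_scope.
Local Open Scope ring_scope.
Set Implicit Arguments.
Unset Strict Implicit.

(** * The Euclidean norm and distances to sets *)

Section EuclideanNorm.
Variables (R : realType) (n : nat).
Implicit Types (x y z : 'rV[R]_n) (A : set 'rV[R]_n).

Lemma sqr_enorm x : enorm x ^+ 2 = \sum_i x ord0 i ^+ 2.
Proof. by rewrite /enorm sqr_sqrtr // sumr_ge0 // => i _; exact: sqr_ge0. Qed.

Lemma enorm_ge0 x : 0 <= enorm x.
Proof. exact: sqrtr_ge0. Qed.

Lemma enorm0_eq0 x : enorm x = 0 -> x = 0.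
Proof.
move=> x0; apply/rowP => i; rewrite mxE; apply/eqP; rewrite -sqrf_eq0.
have /eqP := sqr_enorm x.
rewrite x0 expr0n eq_sym psumr_eq0 => [/allP|j _]; last exact: sqr_ge0.
by move=> /(_ i); rewrite mem_index_enum => /(_ isT).
Qed.

Lemma enorm_coord x i : `|x ord0 i| <= enorm x.
Proof.
rewrite -sqrtr_sqr ler_sqrt; last by rewrite sumr_ge0 // => j _; exact: sqr_ge0.
by rewrite (bigD1 i) //= lerDl sumr_ge0 // => j _; exact: sqr_ge0.
Qed.

Lemma enorm_le_cube x t : 0 <= t -> (forall i, `|x ord0 i| <= t) ->
  enorm x <= Num.sqrt n%:R * t.
Proof.
move=> t0 xt; have -> : t = Num.sqrt (t ^+ 2) by rewrite sqrtr_sqr ger0_norm.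
rewrite -sqrtrM ?ler0n //.
rewrite ler_wsqrtr // mulr_natl -[in leRHS](card_ord n) -sumr_const ler_sum // => i _.
by rewrite -real_normK ?num_real // ler_pXn2r ?nnegrE.
Qed.

(* AM-GM with weights [enorm y / enorm x] and [enorm x / enorm y]. *)
Lemma cauchy_schwarz x y :
  \sum_i x ord0 i * y ord0 i <= enorm x * enorm y.
Proof.
have [x0|/eqP x0] := eqVneq (enorm x) 0.
  rewrite x0 mul0r (enorm0_eq0 x0) big1 // => i _; by rewrite mxE mul0r.
have [y0|/eqP y0] := eqVneq (enorm y) 0.
  rewrite y0 mulr0 (enorm0_eq0 y0) big1 // => i _; by rewrite mxE mulr0.
have a0 : 0 < enorm x by rewrite lt0r enorm_ge0 andbT; apply/eqP.
have b0 : 0 < enorm y by rewrite lt0r enorm_ge0 andbT; apply/eqP.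
set a := enorm x in a0 *; set b := enorm y in b0 *.
have -> : a * b = \sum_i (b / a * x ord0 i ^+ 2 + a / b * y ord0 i ^+ 2) / 2.
  rewrite -mulr_suml big_split /= -!mulr_sumr -!sqr_enorm -/a -/b.
  field; lra.
apply: ler_sum => i _; rewrite -subr_ge0.
have -> : (b / a * x ord0 i ^+ 2 + a / b * y ord0 i ^+ 2) / 2 - x ord0 i * y ord0 i
  = (b * x ord0 i - a * y ord0 i) ^+ 2 / (2 * a * b) by field; lra.
by rewrite divr_ge0 ?sqr_ge0 // !mulr_ge0 // ltW.
Qed.

Lemma enormD x y : enorm (x + y) <= enorm x + enorm y.
Proof.
rewrite -(@ler_pXn2r _ 2) ?nnegrE ?addr_ge0 ?enorm_ge0 //.
have := cauchy_schwarz x y; rewrite sqrrD !sqr_enorm => xy.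
have -> : \sum_i (x + y) ord0 i ^+ 2 = \sum_i x ord0 i ^+ 2
   + (\sum_i x ord0 i * y ord0 i) *+ 2 + \sum_i y ord0 i ^+ 2.
  rewrite -sumrMnl -!big_split /=; apply: eq_bigr => i _; rewrite mxE; ring.
lra.
Qed.

Lemma edistanceC x y : edistance x y = edistance y x.
Proof.
rewrite /edistance /enorm; congr Num.sqrt; apply: eq_bigr => i _.
by rewrite !mxE -[LHS]sqrrN opprB.
Qed.

Lemma edistance_ge0 x y : 0 <= edistance x y.
Proof. exact: enorm_ge0. Qed.

Lemma edistancexx x : edistance x x = 0.
Proof.
rewrite /edistance subrr /enorm big1 ?sqrtr0 // => i _.
by rewrite mxE expr0n.
Qed.

Lemma edistance_triangle y x z : edistance x z <= edistance x y + edistance y z.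
Proof. by rewrite /edistance -(subrKA y); exact: enormD. Qed.

Lemma dist_pt_has_lbound x A : has_lbound [set edistance x y | y in A].
Proof. by exists 0 => _ [y _ <-]; exact: edistance_ge0. Qed.

Lemma dist_pt_le x y A : A y -> dist_pt x A <= edistance x y.
Proof. by move=> Ay; apply: ge_inf; [exact: dist_pt_has_lbound|exists y]. Qed.

Lemma dist_pt_ge x A t : A !=set0 -> (forall y, A y -> t <= edistance x y) ->
  t <= dist_pt x A.
Proof.
move=> [y0 Ay0] tA; apply: lb_le_inf; first by exists (edistance x y0), y0.
by move=> _ [y Ay <-]; exact: tA.
Qed.

Lemma dist_pt_ge0 x A : 0 <= dist_pt x A.
Proof.
have [->|/set0P A0] := eqVneq A set0; first by rewrite /dist_pt image_set0 inf0.
by apply: dist_pt_ge => // y _; exact: edistance_ge0.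
Qed.

Lemma dist_pt_adherent x A e : A !=set0 -> 0 < e ->
  exists2 y, A y & edistance x y < dist_pt x A + e.
Proof.
move=> [y0 Ay0] e0; have [|_ [y Ay <-] xy] := @inf_adherent _ [set edistance x y | y in A] _ e0.
  by split; [exists (edistance x y0), y0|exact: dist_pt_has_lbound].
by exists y.
Qed.

Lemma dist_pt_lipschitz x y A : dist_pt x A <= edistance x y + dist_pt y A.
Proof.
have [->|/set0P A0] := eqVneq A set0.
  by rewrite /dist_pt !image_set0 inf0 addr0 edistance_ge0.
rewrite -lerBlDl; apply: dist_pt_ge => // z Az; rewrite lerBlDl.
exact: le_trans (dist_pt_le x Az) (edistance_triangle _ _ _).
Qed.

End EuclideanNorm.

(** * Whitney cubes: depth of their points, and packing of the cubes near a point *)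

Section WhitneyGeometry.
Variables (R : realType) (n : nat) (Omega : set 'rV[R]_n) (C : set (cube R n)).
Hypotheses (n_gt0 : (0 < n)%N) (wC : whitney_decomposition Omega C).
Implicit Types (Q : cube R n) (x y : 'rV[R]_n).

Local Notation depth x := (dist_pt x (boundary Omega)).
Local Notation s := (Num.sqrt n%:R : R).

Lemma sqrt_dim_ge1 : 1 <= s.
Proof. by rewrite -[leLHS]sqrtr1 ler_wsqrtr // ler1n. Qed.

Lemma corner_in_cube Q : 0 < side Q -> cube_set Q Q.1.
Proof. by move=> l0 i; rewrite lexx /= lerDl ltW. Qed.

Lemma cube_diameter Q x y : 0 < side Q -> cube_set Q x -> cube_set Q y ->
  edistance x y <= s * side Q.
Proof.
move=> l0 Qx Qy; apply: enorm_le_cube; first exact: ltW.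
move=> i; rewrite !mxE ler_norml.
have /andP[? ?] := Qx i; have /andP[? ?] := Qy i.
apply/andP; split; lra.
Qed.

Lemma closed_nbhd_near Q r x : 0 < side Q ->
  closed_nbhd (cube_set Q) r x ->
  forall e, 0 < e -> exists2 z, cube_set Q z & edistance x z < r + e.
Proof.
move=> l0 xr e e0.
have [|z Qz xz] := @dist_pt_adherent _ _ x (cube_set Q) e _ e0.
  by exists Q.1; exact: corner_in_cube.
by exists z => //; apply: lt_le_trans xz _; rewrite lerD2r.
Qed.

(** Were the boundary empty, [dist_set] would be [inf set0 = 0], against its positive Whitney lower
    bound. *)
Lemma boundary_neq0 Q : C Q -> boundary Omega !=set0.
Proof.
move=> CQ; apply/set0P/eqP => B0.
have l0 := whitney_side_gt0 wC CQ; have /andP[+ _] := whitney_dist wC CQ.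
have -> : dist_set (cube_set Q) (boundary Omega) = 0.
  rewrite /dist_set (_ : [set d | _] = set0) ?inf0 //.
  by apply/seteqP; split => // d [x [y []]]; rewrite B0.
apply/negP; rewrite -ltNge mulr_gt0 //; exact: lt_le_trans sqrt_dim_ge1.
Qed.

Lemma cube_boundary_dist Q x y : C Q -> cube_set Q x -> boundary Omega y ->
  s * side Q <= edistance x y.
Proof.
move=> CQ Qx By; have /andP[+ _] := whitney_dist wC CQ.
move=> /le_trans; apply; apply: ge_inf; last by exists x, y.
by exists 0 => _ [a [b [_ _ ->]]]; exact: edistance_ge0.
Qed.

(** An almost nearest pair is at most [4 * s * side Q + e] apart; the diameter of the cube adds one
    more [s * side Q]. *)
Lemma depth_le_side Q x : C Q -> cube_set Q x -> depth x <= 5 * s * side Q.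
Proof.
move=> CQ Qx; have l0 := whitney_side_gt0 wC CQ.
have /andP[_ Bd] := whitney_dist wC CQ.
apply/ler_addgt0Pr => e e0.
have [|_ [a [b [Qa Bb ->]]] ab] := @inf_adherent _
    [set d | exists a b, [/\ cube_set Q a, boundary Omega b & d = edistance a b]] _ e0.
  split; last by exists 0 => _ [a [b [_ _ ->]]]; exact: edistance_ge0.
  have [b Bb] := boundary_neq0 CQ.
  by exists (edistance x b), x, b.
have := dist_pt_le x Bb; have := edistance_triangle a x b.
have := cube_diameter l0 Qx Qa; move: ab Bd; rewrite /dist_set; lra.
Qed.

(** Points of [Q] have depth at least [s * side Q]; moving by [side Q / 4] loses at most a quarter
    of this, as [1 <= s]. *)
Lemma near_depth_ge Q x : C Q -> closed_nbhd (cube_set Q) (side Q / 4) x ->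
  3 / 4 * s * side Q <= depth x.
Proof.
move=> CQ Nx; have l0 := whitney_side_gt0 wC CQ.
apply: dist_pt_ge => [|y By]; first exact: boundary_neq0 CQ.
apply/ler_addgt0Pr => e e0.
have [z Qz xz] := closed_nbhd_near l0 Nx e0.
have := cube_boundary_dist CQ Qz By; have := edistance_triangle x z y.
rewrite (edistanceC z x) => h1 h2.
have : side Q <= s * side Q by rewrite ler_peMl ?sqrt_dim_ge1 // ltW.
lra.
Qed.

Lemma near_depth_le Q x : C Q -> closed_nbhd (cube_set Q) (side Q / 4) x ->
  depth x <= 6 * s * side Q.
Proof.
move=> CQ Nx; have l0 := whitney_side_gt0 wC CQ.
apply/ler_addgt0Pr => e e0.
have [z Qz xz] := closed_nbhd_near l0 Nx e0.
have := dist_pt_lipschitz x z (boundary Omega); have := depth_le_side CQ Qz => h1 h2.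
have : side Q <= s * side Q by rewrite ler_peMl ?sqrt_dim_ge1 // ltW.
lra.
Qed.

Lemma near_corner Q x i : 0 < side Q ->
  closed_nbhd (cube_set Q) (side Q / 4) x ->
  `|Q.1 ord0 i - x ord0 i| <= 2 * side Q.
Proof.
move=> l0 Nx; have l1 : 0 < 3 / 4 * side Q by lra.
have [z Qz xz] := closed_nbhd_near l0 Nx l1.
have := enorm_coord (x - z) i; rewrite -/(edistance x z) !mxE ler_norml => /andP[h1 h2].
by have /andP[h3 h4] := Qz i; rewrite ler_norml; apply/andP; split; lra.
Qed.

Lemma interior_cube Q x t : 0 < t ->
  (forall i, Q.1 ord0 i + t <= x ord0 i <= Q.1 ord0 i + side Q - t) ->
  (cube_set Q)° x.
Proof.
move=> t0 xt; apply/nbhs_ballP; exists t => //= y [_ xy] i.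
have := xy ord0 i; rewrite /ball /= ltr_norml => /andP[h1 h2].
by have /andP[h3 h4] := xt i; apply/andP; split; lra.
Qed.

(* Indices, in the grid based at [x] of mesh [depth x / (18 sqrt n)], of the
   cell containing the least corner of Q. If [x] is near Q, the side of Q is at
   least three meshes, so the cell determines an interior point of Q. *)
Definition corner_cell x Q : {ffun 'I_n -> 'I_109} :=
  [ffun i => inord (Num.truncn ((Q.1 ord0 i - x ord0 i) / (depth x / s / 18) + 54))].

(** Cubes near [x] with the same cell share an interior point [w], hence coincide by disjointness of
    interiors. *)
Lemma corner_cell_inj x Q Q' : C Q -> C Q' ->
  closed_nbhd (cube_set Q) (side Q / 4) x ->
  closed_nbhd (cube_set Q') (side Q' / 4) x ->
  corner_cell x Q = corner_cell x Q' -> Q = Q'.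
Proof.
move=> CQ CQ' NQ NQ'; have s1 := sqrt_dim_ge1.
have s0 : 0 < s by exact: lt_le_trans s1.
have l0 := whitney_side_gt0 wC CQ.
set t := depth x / s / 18.
have dE : depth x = 18 * s * t by rewrite /t; field; rewrite gt_eqF.
have t0 : 0 < t.
  rewrite !divr_gt0 //; apply: lt_le_trans (near_depth_ge CQ NQ).
  by rewrite !mulr_gt0 //; lra.
(* Cell [k] puts the corner coordinate in [[x + (k - 54) t, x + (k - 53) t)], so [w] lies more than
   [t] and at most [2 t] above it; a side of at least [3 t] leaves another [t]. *)
pose w : 'rV[R]_n := \row_i (x ord0 i + t * ((corner_cell x Q i : nat)%:R - 52)).
have main P : C P -> closed_nbhd (cube_set P) (side P / 4) x ->
    corner_cell x Q = corner_cell x P -> (cube_set P)° w.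
  move=> CP NP E; apply: (interior_cube t0) => i; rewrite mxE E ffunE -/t {E}.
  have p0 := whitney_side_gt0 wC CP.
  have := near_depth_ge CP NP; have := near_depth_le CP NP; rewrite dE.
  move=> p1 p2.
  (* [q1] and [q2] say [3 t <= side P <= 24 t]; the corner is then within [48 t] of [x] in each
     coordinate, and the indices stay below 109. *)
  have q1 : 18 * t <= 6 * side P by rewrite -(ler_pM2l s0); lra.
  have q2 : 3 / 4 * side P <= 18 * t by rewrite -(ler_pM2l s0); lra.
  have := near_corner i p0 NP; rewrite ler_norml => /andP[c1 c2].
  set a := P.1 ord0 i - x ord0 i.
  have aE : P.1 ord0 i = x ord0 i + t * (a / t) by rewrite /a; field; lra.
  have at1 : - 54 <= a / t by rewrite ler_pdivlMr // /a; lra.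
  have at2 : a / t <= 54 by rewrite ler_pdivrMr // /a; lra.
  have k0 : 0 <= a / t + 54 by lra.
  have /andP[k1 k2] := truncn_itv k0.
  rewrite inordK; last first.
    by rewrite ltnS truncn_le_nat; lra.
  move: k1 k2; set k := Num.truncn _; rewrite -natr1 => k1 k2.
  rewrite aE; set b := a / t in k1 k2 *.
  have b1 : t * b <= t * (k%:R - 53) by rewrite ler_pM2l //; lra.
  have b2 : t * (k%:R - 54) <= t * b by rewrite ler_pM2l //; lra.
  by apply/andP; split; lra.
move=> EQ; apply: (whitney_disjoint wC) => //; exists w; split; exact: main.
Qed.

(** [corner_cell x] injects these cubes into the functions from ['I_n] to ['I_109]. *)
Lemma near_cubes_bound x (S : seq (cube R n)) : uniq S ->
  (forall Q, Q \in S -> C Q /\ closed_nbhd (cube_set Q) (side Q / 4) x) ->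
  (size S <= 109 ^ n)%N.
Proof.
move=> uS SC.
have : uniq (map (corner_cell x) S).
  rewrite map_inj_in_uniq // => Q Q' /SC[? ?] /SC[? ?]; exact: corner_cell_inj.
move=> /card_uniqP; rewrite size_map => <-.
by rewrite (leq_trans (max_card _)) // card_ffun !card_ord.
Qed.

End WhitneyGeometry.

(** * Optimal matchings and the minimal cost *)

Section MinCost.
Variables (R : realType) (m : nat) (Y : Type) (d : Y -> Y -> R).
Implicit Types (y z : 'I_m -> Y) (s : 'S_m).

Lemma min_cost_attained y z : exists s, min_cost d y z = matching_cost d y z s.
Proof.
rewrite /min_cost; elim/big_ind: _ => [|a b [s ->] [t ->]|s _]; last by exists s.
- by exists 1%g.
- by rewrite minEle; case: ifP => _; [exists s|exists t].
Qed.

Lemma min_cost_le y z s : min_cost d y z <= matching_cost d y z s.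
Proof. exact: bigmin_le. Qed.

Lemma sqr_matching_cost y z s :
  matching_cost d y z s ^+ 2 = \sum_i d (y i) (z (s i)) ^+ 2.
Proof. by rewrite /matching_cost sqr_sqrtr // sumr_ge0 // => i _; exact: sqr_ge0. Qed.

Lemma matching_cost_ge0 y z s : 0 <= matching_cost d y z s.
Proof. exact: sqrtr_ge0. Qed.

Lemma min_cost_ge0 y z : 0 <= min_cost d y z.
Proof. by have [s ->] := min_cost_attained y z; exact: matching_cost_ge0. Qed.

Lemma sqr_min_cost_le y z s :
  min_cost d y z ^+ 2 <= \sum_i d (y i) (z (s i)) ^+ 2.
Proof.
rewrite -(sqr_matching_cost y z s) ler_pXn2r ?nnegrE ?min_cost_ge0 ?matching_cost_ge0 //.
exact: min_cost_le.
Qed.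

Lemma matching_cost_ge y z s i : d (y i) (z (s i)) <= matching_cost d y z s.
Proof.
apply: le_trans (ler_norm _) _; rewrite -sqrtr_sqr ler_wsqrtr // (bigD1 i) //=.
by rewrite lerDl sumr_ge0 // => j _; exact: sqr_ge0.
Qed.

End MinCost.

Lemma W2_push (R : realType) (m : nat) (Y Z : choiceType) (d : Z -> Z -> R)
    (f : Y -> Z) (p q : utuple m Y) :
  W2 d (push f p) (push f q) = min_cost d (f \o points p) (f \o points q).
Proof. exact: W2_dirac_sum. Qed.

(** * The upper bound, by packing *)

Section UpperBound.
Variables (R : realType) (n : nat) (Omega : set 'rV[R]_n) (C : set (cube R n)).
Variable phi : cube R n -> shortcut Omega -> 'rV[R]_n.+1.
Hypotheses (n_gt0 : (0 < n)%N) (wC : whitney_decomposition Omega C).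
Hypothesis wphi : forall Q, C Q -> whitney_map Q (phi Q).
Implicit Types (S : seq (cube R n)) (x y : shortcut Omega).

Lemma near_cubes_count S x : uniq S -> (forall Q, Q \in S -> C Q) ->
  (count (fun Q => `[< near_cube Q (side Q / 4) x >]) S <= 109 ^ n)%N.
Proof.
move=> uS SC; case: x => [x|]; last first.
  (* The added point is near no cube. *)
  by rewrite (eq_count (_ : _ =1 pred0)) ?count_pred0 // => Q; exact: asboolF.
rewrite -size_filter; apply: (near_cubes_bound n_gt0 wC (x := val x)).
  exact: filter_uniq.
by move=> Q; rewrite mem_filter => /andP[/asboolP NQ /SC].
Qed.

(** Each term is at most [M] by the Lipschitz bound and vanishes unless [x] or [y] is near [Q]; each
    of these two points is near at most [109 ^ n] cubes. *)
Lemma sum_phi_dist_le S x y : uniq S -> (forall Q, Q \in S -> C Q) ->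
  \sum_(Q <- S) edistance (phi Q x) (phi Q y) ^+ 2
    <= 162 * n.+1%:R * 109 ^+ n * delta x y ^+ 2.
Proof.
move=> uS SC; set M := 81 * n.+1%:R * delta x y ^+ 2.
have M0 : 0 <= M by rewrite /M mulr_ge0 ?sqr_ge0 ?mulr_ge0 ?ler0n.
pose N (z : shortcut Omega) (Q : cube R n) := `[< near_cube Q (side Q / 4) z >].
have le_term Q : Q \in S -> edistance (phi Q x) (phi Q y) ^+ 2
    <= M * (N x Q : nat)%:R + M * (N y Q : nat)%:R.
  move=> /SC CQ.
  have dM : edistance (phi Q x) (phi Q y) ^+ 2 <= M.
    have dL := wmap_lipschitz_delta (wphi CQ) x y.
    have -> : M = (9 * Num.sqrt n.+1%:R * delta x y) ^+ 2.
      by rewrite !exprMn sqr_sqrtr ?ler0n // /M; ring.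
    have e0 := edistance_ge0 (phi Q x) (phi Q y).
    by rewrite ler_pXn2r // nnegrE // (le_trans e0).
  rewrite /N; case: asboolP => Nx; case: asboolP => Ny /=;
    rewrite ?mulr1 ?mulr0 ?addr0 ?add0r //.
  - by rewrite (le_trans dM) // lerDl.
  - by rewrite !(wmap_support (wphi CQ)) // edistancexx expr0n.
have -> : 162 * n.+1%:R * 109 ^+ n * delta x y ^+ 2
    = M * (109 ^ n)%:R + M * (109 ^ n)%:R.
  by rewrite natrX /M; ring.
rewrite big_seq (le_trans (ler_sum _ le_term)) // -big_seq big_split /= -!mulr_sumr.
have cnt z : M * (\sum_(Q <- S) (N z Q : nat)%:R) <= M * (109 ^ n)%:R.
  rewrite ler_wpM2l // -natr_sum ler_nat.
  rewrite (eq_bigr (fun Q => if N z Q then 1 else 0)%N) => [|Q _]; last by case: (N z Q).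
  by rewrite -big_mkcond sum1_count near_cubes_count.
exact: lerD.
Qed.

(** An optimal matching for [delta] is a competitor for every [phi Q]; after exchanging the sums the
    bound holds pair by pair. *)
Lemma sum_W2_push_le m (p q : utuple m (shortcut Omega)) S :
  uniq S -> (forall Q, Q \in S -> C Q) ->
  \sum_(Q <- S) W2 (@edistance R n.+1) (push (phi Q) p) (push (phi Q) q) ^+ 2
    <= 162 * n.+1%:R * 109 ^+ n * W2 (@delta R n Omega) p q ^+ 2.
Proof.
move=> uS SC; rewrite [in leRHS]/W2.
have [s ->] := min_cost_attained (@delta R n Omega) (points p) (points q).
rewrite sqr_matching_cost mulr_sumr.
apply: (@le_trans _ _ (\sum_i \sum_(Q <- S)
   edistance (phi Q (points p i)) (phi Q (points q (s i))) ^+ 2)).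
  rewrite exchange_big /=; apply: ler_sum => Q _.
  by rewrite W2_push; exact: sqr_min_cost_le.
by apply: ler_sum => i _; exact: sum_phi_dist_le.
Qed.

Lemma esum_W2_push_le m (p q : utuple m (shortcut Omega)) :
  (\esum_(Q in C)
     (W2 (@edistance R n.+1) (push (phi Q) p) (push (phi Q) q) ^+ 2)%:E
   <= (162 * n.+1%:R * 109 ^+ n * W2 (@delta R n Omega) p q ^+ 2)%:E)%E.
Proof.
apply: ge_ereal_sup => _ [F [finF FC] <-].
rewrite fsbig_finite //= sumEFin lee_fin; apply: sum_W2_push_le; first exact: fset_uniq.
by move=> Q; rewrite in_fset_set // inE; exact: FC.
Qed.

End UpperBound.

(** The permutation may vary with [a]: it only shows that the two classes of [Some a] have equal
    sizes. All sizes sum to [m], so the classes of [None] agree too, and [f] and [g] enumerate one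
    multiset. *)
Lemma matching_of_labels (m : nat) (T : finType) (f g : 'I_m -> option T) :
  (forall a, exists s : 'S_m, forall i, (f i == Some a) = (g (s i) == Some a)) ->
  exists s : 'S_m, forall i, f i = g (s i).
Proof.
move=> fg.
have eqS a : (\sum_(i < m) (f i == Some a) = \sum_(i < m) (g i == Some a))%N.
  have [s fgs] := fg a; rewrite [RHS](reindex_inj (@perm_inj _ s)).
  by apply: eq_bigr => i _; rewrite fgs.
have total (h : 'I_m -> option T) :
    (\sum_(i < m) (h i == None) + \sum_a \sum_(i < m) (h i == Some a) = m)%N.
  rewrite exchange_big -big_split /= -[RHS]card_ord -sum1_card.
  apply: eq_bigr => i _; case: (h i) => [b|]; last by rewrite big1.
  rewrite (bigD1 b) //= eqxx big1 // => a ab; apply/eqP; rewrite eqb0.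
  by apply: contraNneq ab => -[->].
have E : dirac_sum f = dirac_sum g.
  apply: val_inj; apply/msetP => -[a|]; rewrite !dirac_sumE; first exact: eqS.
  apply: (@addIn (\sum_a \sum_(i < m) (g i == Some a))%N).
  rewrite total -[RHS](total f); congr (_ + _)%N.
  by apply: eq_bigr => a _; rewrite eqS.
have [s fs] := points_dirac_sum f; have [t gt] := points_dirac_sum g.
by exists (s^-1 * t)%g => i; rewrite permM -gt -E fs permKV.
Qed.

(** * Chains of nearby points *)

Section Chains.
Variables (R : realType) (n : nat) (Omega : set 'rV[R]_n).
Variables (V : finType) (pos : V -> shortcut Omega) (t : R).

(** A vertex placed at the added point has no edges, so it is a component by itself. *)
Definition edge : rel V := fun u v =>
  if pos u is Some x then
    if pos v is Some y then edistance (val x) (val y) <= t else false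
  else false.

Lemma edge_sym : symmetric edge.
Proof.
by move=> u v; rewrite /edge; case: (pos u) (pos v) => [x|] [y|] //; rewrite edistanceC.
Qed.

Lemma edge_connect_sym : connect_sym edge.
Proof. exact: sym_connect_sym edge_sym. Qed.

Lemma path_edge_dist u p x : path edge u p -> pos u = Some x ->
  exists2 y, pos (last u p) = Some y & edistance (val x) (val y) <= (size p)%:R * t.
Proof.
elim: p u x => [|v p IH] u x /=.
  by move=> _ ux; exists x => //; rewrite edistancexx mul0r.
rewrite {1}/edge => /andP[+ vp] ux; rewrite ux.
case vy : (pos v) => [y|//] xy; have [z pz yz] := IH v y vp vy.
exists z => //; apply: le_trans (edistance_triangle (val y) _ _) _.
by rewrite -nat1r mulrDl mul1r lerD.
Qed.

(** A path without repeated vertices has fewer than [#|V|] edges. *)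
Lemma connect_edge_dist u v x : 0 <= t -> connect edge u v -> pos u = Some x ->
  exists2 y, pos v = Some y & edistance (val x) (val y) <= #|V|%:R * t.
Proof.
move=> t0 /connectP[p up ->{v}] ux; case/shortenP: up => p' up' uniqp' _.
have [y py xy] := path_edge_dist up' ux; exists y => //.
apply: le_trans xy _; rewrite ler_wpM2r // ler_nat.
by have := max_card (mem (u :: p')); rewrite (card_uniqP uniqp') => /ltnW.
Qed.

End Chains.

(** * The lower bound, by components of nearby points *)

Section LowerBound.
Variables (R : realType) (n : nat) (Omega : set 'rV[R]_n) (C : set (cube R n)).
Variable phi : cube R n -> shortcut Omega -> 'rV[R]_n.+1.
Hypotheses (n_gt0 : (0 < n)%N) (wC : whitney_decomposition Omega C).
Hypothesis wphi : forall Q, C Q -> whitney_map Q (phi Q).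
Variables (m : nat) (y z : 'I_m -> shortcut Omega) (r : R).
Hypotheses (m_gt0 : (0 < m)%N) (r_ge0 : 0 <= r).
Hypothesis cost_le : forall Q, C Q ->
  min_cost (@edistance R n.+1) (phi Q \o y) (phi Q \o z) <= r.

Local Notation s := (Num.sqrt n%:R : R).

Lemma delta_ge0 (x x' : shortcut Omega) : 0 <= delta x x'.
Proof.
case: x x' => [x|] [x'|] //=; rewrite ?dist_pt_ge0 //.
by rewrite le_min edistance_ge0 addr_ge0 // dist_pt_ge0.
Qed.

Lemma delta_le_depths (x x' : shortcut Omega) :
  delta x x' <= delta x None + delta x' None.
Proof.
by case: x x' => [x|] [x'|] //=; rewrite ?add0r ?addr0 // ge_min lexx orbT.
Qed.

Let pos (v : 'I_m + 'I_m) : shortcut Omega :=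
  match v with inl i => y i | inr i => z i end.

Let E := edge pos (2 * s * r).

Let step_ge0 : 0 <= 2 * s * r.
Proof. by rewrite !mulr_ge0 // sqrtr_ge0. Qed.

(* The points of a good component stay so far from the boundary that the whole
   component lies near a single Whitney cube. *)
Let good (a : 'I_m + 'I_m) :=
  [forall u, connect E a u ==> (160 * n%:R * m%:R * r < delta (pos u) None)].

(** All bad components share the label [None]: counting controls only their union. *)
Let label v :=
  if good (fingraph.root E v) then Some (fingraph.root E v) else None.

Let connected_dist u v x : connect E u v -> pos u = Some x ->
  exists2 x', pos v = Some x' & edistance (val x) (val x') <= 4 * m%:R * (s * r).
Proof.
move=> uv ux; have [x' vx' xx'] := connect_edge_dist step_ge0 uv ux.
exists x' => //; apply: le_trans xx' _.
(* There are [2 m] vertices, and edges have length at most [2 * s * r]. *)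
by rewrite card_sum card_ord addnn -muln2 natrM; lra.
Qed.

Let sr_le : r <= m%:R * (s * r).
Proof.
have sr : r <= s * r by rewrite ler_peMl // sqrt_dim_ge1.
by rewrite (le_trans sr) // ler_peMl ?ler1n // (le_trans r_ge0).
Qed.

(** As [n] is [s ^+ 2], this expresses the depth threshold through [m * (s * r)], the unit of
    component diameters. *)
Let ssr : n%:R * m%:R * r = s * (m%:R * (s * r)).
Proof. by rewrite -{1}[n%:R]sqr_sqrtr ?ler0n //; ring. Qed.

(** [Q] is the cube containing the point of [a]. The component is so small compared with [Q] that
    [wmap_separated] applies at all its points; images at most [r < side Q] apart then come from
    points at most [2 s r] apart, which are joined by an edge. *)
Lemma good_component_cube a : good a ->
  exists2 Q, C Q & forall u v, connect E a u ->
    edistance (phi Q (pos u)) (phi Q (pos v)) <= r -> connect E a v.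
Proof.
move=> /forallP ga; have s1 : 1 <= s := sqrt_dim_ge1 R n_gt0.
have s0 : 0 < s by exact: lt_le_trans s1.
have := ga a; rewrite connect0 implyTb.
case ax : (pos a) => [x0|] /=; last first.
  by rewrite ltNge !mulr_ge0 ?ler0n.
move=> x0far; have [Q CQ Qx0] : (\bigcup_(Q in C) cube_set Q) (val x0).
  by rewrite (whitney_cover wC); exact: set_valP.
have l0 := whitney_side_gt0 wC CQ.
have x0le := depth_le_side n_gt0 wC CQ Qx0.
(* The depth exceeds [160 n m r] and is at most [5 s * side Q]; since [32 / 8 = 4], the component
   fits in the [side Q / 8] neighbourhood. *)
have lbig : 32 * (m%:R * (s * r)) < side Q.
  have : 160 * (n%:R * m%:R * r) < 5 * s * side Q by lra.
  by rewrite ssr => far; rewrite -(ltr_pM2l s0); lra.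
have r_lt : r < side Q by have := sr_le; lra.
exists Q => // u v au uv.
have [x ux x0x] := connected_dist au ax.
have Nx : closed_nbhd (cube_set Q) (side Q / 8) (val x).
  rewrite /closed_nbhd /= (le_trans (dist_pt_le _ Qx0)) // edistanceC.
  by rewrite (le_trans x0x) //; lra.
apply: connect_trans au (connect1 _); rewrite /E /edge ux.
move: uv; rewrite ux; have := wmap_separated (wphi CQ) (pos v) Nx.
case: (pos v) => [x'|] /= sep ur; last by have := le_trans sep ur; rewrite leNgt r_lt.
have := le_trans sep ur; rewrite ge_min => /orP[|]; last by rewrite leNgt r_lt.
by rewrite ler_pdivrMr ?mulr_gt0 // [r * _]mulrC.
Qed.

(** For a good component, the optimal matching of the [phi Q] images moves each image by at most
    [r], so no pair has exactly one point in the component. *)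
Lemma label_matching :
  exists t : 'S_m, forall i, label (inl i) = label (inr (t i)).
Proof.
apply: (@matching_of_labels m _ (fun i => label (inl i)) (fun i => label (inr i))) => a.
have labelE v : (label v == Some a) = (fingraph.root E v == a) && good a.
  rewrite /label; case: ifP => g.
    have [<-|] := eqVneq (fingraph.root E v) a; first by rewrite g eqxx.
    by move=> /eqP va; apply/eqP => -[].
  by have [<-|//] := eqVneq (fingraph.root E v) a; rewrite g.
have [ga|/negbTE ga] := boolP (good a); last first.
  (* [label] never equals [Some a] here, so any permutation serves. *)
  by exists 1%g => i; rewrite !labelE ga !andbF.
have Esym := edge_connect_sym pos (2 * s * r).
have [Q CQ closed] := good_component_cube ga.
have [t tE] := min_cost_attained (@edistance R n.+1) (phi Q \o y) (phi Q \o z).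
exists t => i; rewrite !labelE ga !andbT.
have dr : edistance (phi Q (y i)) (phi Q (z (t i))) <= r.
  apply: le_trans (cost_le CQ); rewrite tE.
  exact: (@matching_cost_ge _ _ _ _ (phi Q \o y) (phi Q \o z)).
(* [a] need not be a root; when it is not, both sides are false. *)
have rootE v : (fingraph.root E v == a) = (fingraph.root E a == a) && connect E a v.
  apply/eqP/andP => [<-|[/eqP {2}<- av]].
    by rewrite root_root // Esym connect_root.
  by apply/esym/eqP; rewrite root_connect.
rewrite (rootE (inl i)) (rootE (inr (t i))); congr (_ && _); apply/idP/idP => h.
  exact: (closed _ (inr (t i)) h).
by apply: (closed _ (inl i) h); rewrite edistanceC.
Qed.

(** Some point of a bad component has depth at most [160 n m r]; the component adds
    [4 m s r <= 4 n m r], since [s <= s^2 = n]. *)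
Lemma bad_depth v : label v = None -> delta (pos v) None <= 164 * (n%:R * m%:R * r).
Proof.
have Esym := edge_connect_sym pos (2 * s * r).
rewrite /label; case: ifP => // /forallP/existsNP [u].
move=> /negP; rewrite negb_imply -leNgt => /andP[vu du] _.
have {}vu : connect E v u by apply: connect_trans vu; exact: connect_root.
case vx : (pos v) => [x|] /=; last by rewrite !mulr_ge0 ?ler0n.
have [x' ux' xx'] := connected_dist vu vx.
move: du; rewrite ux' /= => du.
have := dist_pt_lipschitz (val x) (val x') (boundary Omega).
have : m%:R * (s * r) <= n%:R * m%:R * r.
  by rewrite ssr ler_peMl ?sqrt_dim_ge1 // (le_trans r_ge0).
lra.
Qed.

(** Each of the [m] pairs contributes at most [(328 n m r)^2], whence the factor [m^3]. *)
Lemma min_cost_delta_le :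
  min_cost (@delta R n Omega) y z ^+ 2 <= (328 * n%:R) ^+ 2 * m%:R ^+ 3 * r ^+ 2.
Proof.
have [t tE] := label_matching.
apply: le_trans (sqr_min_cost_le _ _ _ t) _.
have -> : (328 * n%:R) ^+ 2 * m%:R ^+ 3 * r ^+ 2
    = \sum_(i < m) (328 * (n%:R * m%:R * r)) ^+ 2.
  by rewrite sumr_const card_ord -mulr_natl; ring.
apply: ler_sum => i _; rewrite ler_pXn2r ?nnegrE ?delta_ge0 //; last first.
  by rewrite !mulr_ge0 ?ler0n.
(* Two bad points are joined through the added point: [164 + 164 = 328]. *)
have [lN|] := eqVneq (label (inl i)) None.
  have zN : label (inr (t i)) = None by rewrite -tE.
  have := bad_depth lN; have := bad_depth zN.
  by have := delta_le_depths (y i) (z (t i)); rewrite /=; lra.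
(* Equal good labels: both points lie in one component, at Euclidean distance at most [4 m s r]. *)
have := tE i; rewrite /label; case: ifP => // g; case: ifP => // _ [] rE _.
have Esym := edge_connect_sym pos (2 * s * r).
have yz : connect E (inl i) (inr (t i)) by rewrite -root_connect // rE.
have := forallP g (inl i); rewrite Esym connect_root implyTb.
case yx : (y i) => [x|] /=; last by rewrite yx /= ltNge !mulr_ge0 ?ler0n.
move=> _; have [x' zx' xx'] := connected_dist yz yx.
rewrite /= in zx'; rewrite zx' /= ge_min (le_trans xx') //.
have : m%:R * (s * r) <= n%:R * m%:R * r.
  by rewrite ssr ler_peMl ?sqrt_dim_ge1 // (le_trans r_ge0).
have := le_trans r_ge0 sr_le; lra.
Qed.

End LowerBound.

(** * Assembly of the two bounds *)

Theorem theorem4p12 (R : realType) (n : nat) :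
  exists c3 : R, 1 <= c3 /\
    forall (m : nat) (Omega : set 'rV[R]_n) (C : set (cube R n))
      (phi : cube R n -> shortcut Omega -> 'rV[R]_n.+1),
      Omega !=set0 -> open Omega -> Omega <> setT ->
      whitney_decomposition Omega C ->
      (forall Q, C Q -> whitney_map Q (phi Q)) ->
      forall p q : utuple m (shortcut Omega),
        ((W2 (@delta R n Omega) p q ^+ 2 / (c3 * m%:R ^+ 3))%:E
          <= \esum_(Q in C)
               (W2 (@edistance R n.+1) (push (phi Q) p) (push (phi Q) q)
                  ^+ 2)%:E)%E
        /\
        (\esum_(Q in C)
            (W2 (@edistance R n.+1) (push (phi Q) p) (push (phi Q) q)
               ^+ 2)%:E
          <= (c3 * W2 (@delta R n Omega) p q ^+ 2)%:E)%E.
Proof.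
pose c1 : R := 162 * n.+1%:R * 109 ^+ n; pose c2 : R := (328 * n%:R) ^+ 2.
have c1_ge1 : 1 <= c1.
  rewrite /c1 -natrX -!natrM ler1n !muln_gt0 expn_gt0 //.
have c2_ge0 : 0 <= c2 := sqr_ge0 _.
(* [c1] serves the upper bound, [c2] the lower one, and the sum dominates both. *)
exists (c1 + c2); split; first by rewrite (le_trans c1_ge1) // lerDl.
move=> m Omega C phi [x0 Ox0] _ OT wC wphi p q.
(* In dimension 0 the space is a single point, so a non-empty [Omega] would not be proper. *)
have n_gt0 : (0 < n)%N.
  rewrite lt0n; apply/eqP => n0; apply: OT; apply/seteqP; split => // x _.
  suff -> : x = x0 by [].
  by apply/rowP => i; have := ltn_ord i; rewrite {2}n0.
set W := W2 (@delta R n Omega) p q; set S := esum _ _.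
have S_ge0 : (0 <= S)%E by apply: esum_ge0 => Q _; rewrite lee_fin sqr_ge0.
have S_le : (S <= (c1 * W ^+ 2)%:E)%E := esum_W2_push_le n_gt0 wC wphi p q.
split; last first.
  by apply: le_trans S_le _; rewrite lee_fin ler_wpM2r ?sqr_ge0 // lerDl.
(* By the upper bound the sum is finite, so the lower bound becomes an inequality of reals. *)
have S_fin : S \is a fin_num.
  by rewrite ge0_fin_numE //; apply: le_lt_trans S_le _; exact: ltry.
rewrite -(fineK S_fin) lee_fin.
have [->|m_gt0] := posnP m.
  (* For [m = 0] the quotient is 0, because the inverse of 0 is 0. *)
  by rewrite expr0n mulr0 invr0 mulr0 fine_ge0.
rewrite ler_pdivrMr; last by rewrite mulr_gt0 ?exprn_gt0 ?ltr0n //; lra.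
have r_ge0 : 0 <= Num.sqrt (fine S) := sqrtr_ge0 _.
have cost_le Q : C Q -> min_cost (@edistance R n.+1)
    (phi Q \o points p) (phi Q \o points q) <= Num.sqrt (fine S).
  (* A single term is a subsum over [[set Q]], hence at most the whole sum. *)
  move=> CQ; rewrite -W2_push -(@ler_pXn2r _ 2) ?nnegrE ?min_cost_ge0 //.
  rewrite sqr_sqrtr ?fine_ge0 // -lee_fin fineK //; apply: esum_ge.
  exists [set Q]; last by rewrite fsbig_set1.
  by split; [exact: finite_set1|move=> _ ->].
have := min_cost_delta_le n_gt0 wC wphi m_gt0 r_ge0 cost_le.
rewrite sqr_sqrtr ?fine_ge0 // -/c2 -/W => /le_trans; apply.
rewrite [leRHS]mulrC ler_wpM2r ?fine_ge0 // ler_wpM2r ?exprn_ge0 ?ler0n //.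
by rewrite lerDr (le_trans ler01).
Qed.
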